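(* Let $L$ be a well-separated completely semidistributive lattice and let $A$ be a set of completely join-irreducible elements of $L$. Then $\bigvee A$ is a canonical join representation if and only if for every pair of elements $\{i,j\}\subseteq A$, $i\neq j$, the join $\bigvee\{i,j\}$ is a canonical join representation. (Equivalently, the canonical join complex of $L$, i.e. the simplicial complex on the set of completely join-irreducible elements of $L$ whose simplices are the sets $A$ for which $\bigvee A$ is a canonical join representation, is a flag complex.)
   Context: $L$ is a complete lattice with least element $\hat 0$ and greatest element $\hat 1$; $\bigvee\emptyset=\hat0$, $\bigwedge\emptyset=\hat1$. An element $j$ is completely join-irreducible if $j=\bigvee X$ with $X\subseteq L$ implies $j\in X$; then $j$ covers a unique element $j_*$. $L$ is completely semidistributive if for all $x,w\in L$ and nonempty $Y\subseteq L$: if $x\vee y=w$ for all $y\in Y$ then $x\vee\bigwedge Y=w$, and if $x\wedge y=w$ for all $y\in Y$ then $x\wedge\bigvee Y=w$. In such a lattice, for each completely join-irreducible $j$ the maximum $\kappa(j)=\max\{y\in L\mid j\wedge y=j_*\}$ exists. $L$ is well-separated if for all $x\not\le y$ in $L$ there is a completely join-irreducible $j$ with $j\le x$ and $y\le\kappa(j)$. A join representation $x=\bigvee A$ ($A\subseteq L$) is canonical if $A$ is an antichain and, for every $B\subseteq L$ with $x=\bigvee B$, every $a\in A$ satisfies $a\le b$ for some $b\in B$. *)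

(* Defs.v *)
From mathcomp Require Import all_boot all_order boolp classical_sets.

Set Implicit Arguments.
Unset Strict Implicit.
Unset Printing Implicit Defensive.

Import Order.TTheory.
Local Open Scope classical_set_scope.
Local Open Scope order_scope.

(* MathComp has no structure of complete lattices: completeness is a predicate
   on bounded lattices. [supremum x0 X] and [infimum x0 X] are the total
   operators of [classical_sets]; they return [x0] on the empty set. *)
Definition complete_lattice d (L : tbLatticeType d) :=
  forall X : set L, supremums X !=set0 /\ infimums X !=set0.

Definition bigjoin d (L : tbLatticeType d) (X : set L) : L := supremum \bot X.
Definition bigmeet d (L : tbLatticeType d) (X : set L) : L := infimum \top X.

Definition is_maximum d (L : tbLatticeType d) (Y : set L) (m : L) :=
  Y m /\ ubound Y m.

Definition is_antichain d (L : tbLatticeType d) (A : set L) :=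
  forall a b, A a -> A b -> a <= b -> a = b.

Definition covers d (L : tbLatticeType d) (x y : L) :=
  y < x /\ forall z, ~ (y < z /\ z < x).

(* Taking [X = set0] shows that [\bot] is excluded. *)
Definition completely_join_irreducible d (L : tbLatticeType d) (j : L) :=
  forall X : set L, j = bigjoin X -> X j.

Definition completely_semidistributive d (L : tbLatticeType d) :=
  forall (x w : L) (Y : set L), Y !=set0 ->
    ((forall y, Y y -> Order.join x y = w) -> Order.join x (bigmeet Y) = w) /\
    ((forall y, Y y -> Order.meet x y = w) -> Order.meet x (bigjoin Y) = w).

(* The element [j_*] covered by [j]. [\bot] is a junk value for elements without
   lower covers; see [lower_coverP] for existence and uniqueness. *)
Definition lower_cover d (L : tbLatticeType d) (j : L) : L :=
  xget \bot [set k | covers j k].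

(* [\bot] is a junk value when there is no maximum; see [kappaP]. *)
Definition kappa d (L : tbLatticeType d) (j : L) : L :=
  xget \bot (is_maximum [set y | Order.meet j y = lower_cover j]).

Definition well_separated d (L : tbLatticeType d) :=
  forall x y : L, ~ x <= y ->
    exists j, [/\ completely_join_irreducible j, j <= x & y <= kappa j].

(* [A] is a canonical join representation of its own join. *)
Definition canonical_join_representation d (L : tbLatticeType d) (A : set L) :=
  is_antichain A /\
  forall B : set L, bigjoin A = bigjoin B ->
    forall a, A a -> exists2 b, B b & a <= b.

(* Simplices are arbitrary, possibly infinite, sets of vertices. *)
Definition simplicial_complex (T : Type) (V : set T) (S : set (set T)) :=
  [/\ forall F, S F -> F `<=` V,
      forall v, V v -> S [set v] &
      forall F G, S F -> G `<=` F -> S G].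

(* Since simplices may be infinite, flagness is not expressed through minimal
   nonfaces: an infinite nonface need not contain a minimal one. *)
Definition flag_complex (T : Type) (V : set T) (S : set (set T)) :=
  simplicial_complex V S /\
  forall F, F `<=` V ->
    (forall i j, F i -> F j -> i <> j -> S [set i; j]) -> S F.

Definition canonical_join_complex d (L : tbLatticeType d) : set (set L) :=
  [set A | A `<=` @completely_join_irreducible d L /\
           canonical_join_representation A].
Arguments canonical_join_complex {d} L _.

Section WellDefined.
Context d (L : tbLatticeType d) (cL : complete_lattice L).
Implicit Types (x y j : L) (X : set L).

Lemma bigjoinP X : supremums X (bigjoin X).
Proof.
rewrite /bigjoin /supremum; case: ifPn => [/eqP ->|_].
  by split=> // x _; exact: le0x.
by apply: xgetPex; have [] := cL X.
Qed.

Lemma bigmeetP X : infimums X (bigmeet X).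
Proof.
rewrite /bigmeet /infimum; case: ifPn => [/eqP ->|_].
  by split=> // x _; exact: lex1.
by apply: xgetPex; have [] := cL X.
Qed.

Lemma lower_coverP j : completely_join_irreducible j ->
  covers j (lower_cover j) /\ forall x, (x < j) = (x <= lower_cover j).
Proof.
move=> jirr; pose k := bigjoin [set x | x < j].
have [ub lub] := bigjoinP [set x | x < j].
have kj : k < j.
  rewrite lt_neqAle; apply/andP; split; last by apply: lub => x /ltW.
  by apply/eqP => /esym /jirr /=; rewrite ltxx.
have kE x : (x < j) = (x <= k).
  by apply/idP/idP => [xj|/le_lt_trans]; [exact: ub|exact].
have kc : covers j k by split=> // z []; rewrite kE => /lt_le_trans h /h; rewrite ltxx.
suff -> : lower_cover j = k by [].
apply: xget_unique => // z [zj nz]; apply/eqP; move: (zj).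
by rewrite kE le_eqVlt => /orP[//|zk]; case: (nz k).
Qed.

Lemma kappaP j : completely_semidistributive L ->
  completely_join_irreducible j ->
  is_maximum [set y | Order.meet j y = lower_cover j] (kappa j).
Proof.
move=> sL /lower_coverP[[/ltW/meet_idPr jk _] _].
set Y := [set y | _]; apply: xgetPex; exists (bigjoin Y).
have Y0 : Y !=set0 by exists (lower_cover j).
split; first by apply: (sL j (lower_cover j) Y Y0).2.
by have [] := bigjoinP Y.
Qed.

End WellDefined.

(* Main.v *)
Require Import Defs.
From mathcomp Require Import all_boot all_order boolp classical_sets.

(**
A set [A] of completely join-irreducible elements is canonical if and only if
[i <= kappa j] for all distinct [i, j] in [A], which is a condition on pairs.
If [A] is canonical and [j] is in [A], then replacing [j] by [j_*] must lower
the join, so the rest of [A] lies below [kappa j]. Conversely, let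
[\/A = \/B] and suppose that [a] in [A] is below no element of [B]. If some [b]
in [B] is not below [kappa a], separate them: [j <= b] and
[kappa a <= kappa j]. Since [j <= \/A], some element of [A] is not below
[kappa j], and this can only be [a]; as every element strictly above [kappa a]
is above [a], [kappa j = kappa a], so [j = a], a contradiction. Hence
[a <= \/B <= kappa a], which is absurd.
*)

Import Order.TTheory.
Local Open Scope classical_set_scope.
Local Open Scope order_scope.

Section CanonicalJoin.
Context {d : Order.disp_t} {L : tbLatticeType d}.
Context (cL : complete_lattice L) (sL : completely_semidistributive L).
Implicit Types (a b i j x y : L) (A B : set L).

Local Notation cji := (@completely_join_irreducible d L).

Lemma bigjoin_ub A x : A x -> x <= bigjoin A.
Proof. by have [ub _] := bigjoinP cL A; exact: ub. Qed.

Lemma bigjoin_le A y : (forall x, A x -> x <= y) -> bigjoin A <= y.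
Proof. by have [_ lub] := bigjoinP cL A; exact: lub. Qed.

Lemma bigmeet_pair x y : bigmeet [set x; y] = Order.meet x y.
Proof.
have [lb glb] := bigmeetP cL [set x; y].
apply/le_anti/andP; split.
  by rewrite lexI !lb //; [right|left].
by apply: glb => z [->|->]; [exact: leIl|exact: leIr].
Qed.

(** Binary join-semidistributivity is the complete law for the set [[set y; z]]. *)
Lemma joinI_eq x y z w : Order.join x y = w -> Order.join x z = w ->
  Order.join x (Order.meet y z) = w.
Proof.
move=> xy xz; rewrite -bigmeet_pair.
have Y0 : [set y; z] !=set0 by exists y; left.
by apply: (sL x w _ Y0).1 => _ [->|->].
Qed.

Lemma lower_cover_lt j : cji j -> lower_cover j < j.
Proof. by case/(lower_coverP cL) => -[]. Qed.

Lemma meet_kappa j : cji j -> Order.meet j (kappa j) = lower_cover j.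
Proof. by case/(kappaP cL sL). Qed.

Lemma lower_cover_le_kappa j : cji j -> lower_cover j <= kappa j.
Proof. by move=> jirr; rewrite -(meet_kappa _ jirr) leIr. Qed.

Lemma not_le_kappa j : cji j -> ~ j <= kappa j.
Proof.
move=> jirr /meet_idPl; rewrite meet_kappa // => jE.
by have := lower_cover_lt _ jirr; rewrite jE ltxx.
Qed.

(** The meet of [j] and [y] is strictly below [j], hence at most [j_*]. As [j_*] is below both, the
    meet equals [j_*], and [kappa j] is the maximum of such [y]. *)
Lemma le_kappa j y : cji j -> lower_cover j <= y -> ~ j <= y -> y <= kappa j.
Proof.
move=> jirr jy njy; have [_ ub] := kappaP cL sL jirr.
have [_ ltE] := lower_coverP cL jirr.
apply: ub; apply/le_anti/andP; split; last first.
  by rewrite lexI jy (ltW (lower_cover_lt _ jirr)).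
rewrite -ltE lt_neqAle leIl andbT; apply/eqP => jE.
by apply: njy; rewrite -jE leIr.
Qed.

Lemma kappa_lt_le j y : cji j -> kappa j < y -> j <= y.
Proof.
move=> jirr ky; apply: contrapT => njy.
have := le_kappa _ _ jirr (le_trans (lower_cover_le_kappa _ jirr) (ltW ky)) njy.
by move=> /(lt_le_trans ky); rewrite ltxx.
Qed.

Lemma kappa_lt_join j : cji j -> kappa j < Order.join (kappa j) j.
Proof.
move=> jirr; rewrite lt_neqAle leUl andbT; apply/eqP => kE.
by apply: (not_le_kappa _ jirr); rewrite kE leUr.
Qed.

(** Both [i] and [j] have the same join with [kappa i], so by semidistributivity their meet has this
    join too. If the meet were not [i], it would lie below [i_*], hence below [kappa i], and the
    join would collapse to [kappa i]. *)
Lemma kappa_inj_le i j : cji i -> cji j -> kappa i = kappa j -> i <= j.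
Proof.
move=> iirr jirr ijE.
have joinE : Order.join (kappa i) i = Order.join (kappa i) j.
  apply/le_anti/andP; split; rewrite leUx leUl /=; apply: kappa_lt_le => //.
    by rewrite ijE kappa_lt_join.
  by rewrite -ijE kappa_lt_join.
have := joinI_eq _ _ _ _ erefl (esym joinE).
have [_ ltE] := lower_coverP cL iirr.
have [/eqP/meet_idPl //|nij] := boolP (Order.meet i j == i).
have : Order.meet i j <= kappa i.
  by rewrite (le_trans _ (lower_cover_le_kappa _ iirr)) // -ltE lt_neqAle nij leIl.
move=> /join_idPl ->; have := kappa_lt_join _ iirr.
by move=> /[swap] <-; rewrite ltxx.
Qed.

Lemma kappa_inj i j : cji i -> cji j -> kappa i = kappa j -> i = j.
Proof. by move=> ? ? ?; apply/le_anti; rewrite !kappa_inj_le. Qed.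

Lemma canonical_le_kappa A i j : A `<=` cji ->
  canonical_join_representation A -> A i -> A j -> i <> j -> i <= kappa j.
Proof.
move=> Airr [anti can] Ai Aj ij; have jirr := Airr _ Aj.
pose B := (A `\ j) `|` [set lower_cover j].
have ltj := lower_cover_lt _ jirr.
have Bi : B i by left.
have Bj : B (lower_cover j) by right.
apply: (le_trans (bigjoin_ub _ _ Bi)).
apply: le_kappa => //; first exact: bigjoin_ub.
(* If [j] were below the join of [B], trading [j] for [j_*] would leave the join of [A]
   unchanged. *)
move=> jB; have AB : bigjoin A = bigjoin B.
  apply/le_anti/andP; split; apply: bigjoin_le => x.
    by move=> Ax; have [->//|xj] := EM (x = j); apply: bigjoin_ub; left.
  move=> [[Ax _]|->]; first exact: bigjoin_ub.
  by apply: (le_trans (ltW ltj)); exact: bigjoin_ub.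
(* Canonicity puts [j] below another element of the antichain [A] or below [j_*]; neither is
   possible. *)
have [b [[Ab bj]|->] jb] := can _ AB _ Aj.
  by apply: bj; rewrite (anti _ _ Aj Ab jb).
by have := le_lt_trans jb ltj; rewrite ltxx.
Qed.

Lemma le_kappa_canonical A : well_separated L -> A `<=` cji ->
  (forall i j, A i -> A j -> i <> j -> i <= kappa j) ->
  canonical_join_representation A.
Proof.
move=> wL Airr Ak; split=> [a b Aa Ab ab|B AB a Aa].
  (* For distinct [a <= b], the hypothesis gives [a <= b <= kappa a]. *)
  apply: contrapT => nab; apply: (not_le_kappa _ (Airr _ Aa)).
  by apply: (le_trans ab); apply: Ak => // /esym.
have airr := Airr _ Aa; apply: contrapT => naB.
apply: (not_le_kappa _ airr).
apply: (@le_trans _ _ (bigjoin B)); first by rewrite -AB bigjoin_ub.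
apply: bigjoin_le => b Bb; apply: contrapT => /wL[j [jirr jb kak]].
have nak : ~ a <= kappa j.
  (* Every other [i] in [A] satisfies [i <= kappa a <= kappa j], so [a <= kappa j] would put the
     whole join, and with it [j], below [kappa j]. *)
  move=> ak; apply: (not_le_kappa _ jirr); apply: (le_trans jb).
  apply: (le_trans (bigjoin_ub _ _ Bb)); rewrite -AB; apply: bigjoin_le => i Ai.
  by have [->//|ia] := EM (i = a); apply: le_trans kak; exact: Ak.
have /(kappa_inj _ _ airr jirr) aj : kappa a = kappa j.
  apply/eqP; move: kak; rewrite le_eqVlt => /orP[//|kak].
  by case: nak; exact: kappa_lt_le.
by apply: naB; exists b => //; rewrite aj.
Qed.

Lemma canonical_pairwiseP A : well_separated L -> A `<=` cji ->
  (canonical_join_representation A <->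
   forall i j, A i -> A j -> i <> j ->
     canonical_join_representation [set i; j]).
Proof.
move=> wL Airr.
have pairirr i j : A i -> A j -> [set i; j] `<=` cji.
  by move=> Ai Aj _ [->|->]; exact: Airr.
split=> [can i j Ai Aj _|can].
  apply: le_kappa_canonical => //; first exact: pairirr.
  have sub : [set i; j] `<=` A by move=> _ [->|->].
  by move=> x y /sub Ax /sub Ay; exact: (canonical_le_kappa A).
apply: le_kappa_canonical => // i j Ai Aj ij.
have [iij jij] : [set i; j] i /\ [set i; j] j by split; [left|right].
exact: (canonical_le_kappa _ _ _ (pairirr _ _ Ai Aj) (can _ _ Ai Aj ij)).
Qed.

End CanonicalJoin.

Local Close Scope order_scope.

Theorem theorem2 (d : Order.disp_t) (L : tbLatticeType d)
    (L_complete : complete_lattice L)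
    (L_semidistributive : completely_semidistributive L)
    (L_separated : well_separated L) :
  (forall A : set L, A `<=` @completely_join_irreducible d L ->
     (canonical_join_representation A <->
      forall i j : L, A i -> A j -> i <> j ->
        canonical_join_representation [set i; j])) /\
  flag_complex (@completely_join_irreducible d L) (canonical_join_complex L).
Proof.
have pairwiseP A := canonical_pairwiseP L_complete L_semidistributive A L_separated.
split=> //; split=> [|F Firr pairF].
  split=> [F []//|v virr|F G [Firr canF] GF].
    have sub1 : [set v] `<=` @completely_join_irreducible d L by move=> _ ->.
    (* A singleton has no two distinct elements, so the pairwise condition is vacuous. *)
    by split=> //; apply/pairwiseP => // i j -> ->.
  have Girr := subset_trans GF Firr; split=> //.
  by apply/pairwiseP => // i j /GF Fi /GF Fj; exact: (pairwiseP F Firr).1.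
by split=> //; apply/pairwiseP => // i j Fi Fj ij; have [] := pairF i j Fi Fj ij.
Qed.
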